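(* Let $X,Y$ be (nonempty) length spaces. Suppose there is a constant $D>0$ such that $d_{\mathrm{GH}}(X,Y)<D$, every loop of diameter $<4D$ in $X$ is nulhomotopic in $X$, and every loop of diameter $<4D$ in $Y$ is nulhomotopic in $Y$. Then the fundamental groups $\pi_1(X)$ and $\pi_1(Y)$ are isomorphic.
   Context: The diameter of a loop is the diameter of its image. For a metric space $(Z,d_Z)$ and nonempty $A,B\subseteq Z$, let $d_Z(z,A)=\inf_{a\in A}d_Z(z,a)$ and let the Hausdorff distance be $d_{\mathrm{H}}^Z(A,B)=\max\left(\sup_{a\in A}d_Z(a,B),\sup_{b\in B}d_Z(b,A)\right)$. The Gromov-Hausdorff distance between nonempty metric spaces $X,Y$ is the value in $[0,\infty]$ given by $d_{\mathrm{GH}}(X,Y)=\inf d_{\mathrm{H}}^Z(X',Y')$, the infimum being over all metric spaces $Z$ and subspaces $X',Y'\subseteq Z$ with $X'$ isometric to $X$ and $Y'$ isometric to $Y$. A metric space $(X,d_X)$ is a length space if for all $x,x'\in X$ the distance $d_X(x,x')$ is the infimum of the lengths of paths $\gamma:[0,1]\to X$ from $x$ to $x'$. In particular (distances being finite) length spaces are path connected, so the fundamental group does not depend on the basepoint up to isomorphism. *)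

(* Defs.v *)
From HB Require Import structures.
From mathcomp Require Import all_boot all_order all_algebra generic_quotient.
From mathcomp Require Import all_classical all_reals all_analysis homotopy.
From mathcomp Require Import ring lra.

Set Implicit Arguments.
Unset Strict Implicit.
Unset Printing Implicit Defensive.

Import Order.TTheory GRing.Theory Num.Theory.
Import numFieldNormedType.Exports.

Local Open Scope classical_set_scope.
Local Open Scope ring_scope.
Local Open Scope quotient_scope.

Section unit_itv.
Variable R : realType.

Definition unit_itv : Type := set_type (`[0, 1] : set R).

HB.instance Definition _ := Topological.on unit_itv.

Definition itv_coord (t : unit_itv) : R := set_val t.

Lemma itv_clampP (r : R) :
  Num.max 0 (Num.min 1 r) \in (`[0, 1]%classic : set R).
Proof.
rewrite inE /= in_itv /= le_max lexx /= ge_max ler01 /=.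
by rewrite ge_min lexx.
Qed.

(* The nearest point of [0, 1]. *)
Definition itv_clamp (r : R) : unit_itv := SigSub (itv_clampP r).

Lemma itv_clampE r : itv_coord (itv_clamp r) = Num.max 0 (Num.min 1 r).
Proof. by []. Qed.

Lemma itv_coord_ge0 t : 0 <= itv_coord t.
Proof. by have := set_mem (valP t); rewrite /= in_itv /= => /andP[]. Qed.

Lemma itv_coord_le1 t : itv_coord t <= 1.
Proof. by have := set_mem (valP t); rewrite /= in_itv /= => /andP[]. Qed.

Lemma itv_coord_inj : injective itv_coord.
Proof. exact: val_inj. Qed.

Lemma itv_coordK : cancel itv_coord itv_clamp.
Proof.
move=> t; apply: itv_coord_inj; rewrite itv_clampE.
by rewrite min_r ?itv_coord_le1 // max_r // itv_coord_ge0.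
Qed.

Lemma itv_clampK r : 0 <= r <= 1 -> itv_coord (itv_clamp r) = r.
Proof. by move=> /andP[r0 r1]; rewrite itv_clampE min_r // max_r. Qed.

Lemma itv_clamp_le0 r : r <= 0 -> itv_clamp r = itv_clamp 0.
Proof.
by move=> r0; apply: itv_coord_inj; rewrite !itv_clampE;
  rewrite !min_r ?ler01 ?(le_trans r0 ler01) // max_l // maxxx.
Qed.

Lemma itv_clamp_ge1 r : 1 <= r -> itv_clamp r = itv_clamp 1.
Proof.
by move=> r1; apply: itv_coord_inj; rewrite !itv_clampE min_l // minxx.
Qed.

Lemma itv_zero_one_neq : itv_clamp 0 != itv_clamp 1.
Proof.
apply/eqP => /(congr1 itv_coord); rewrite !itv_clampK ?lexx ?ler01 //.
by move/eqP; rewrite eq_sym oner_eq0.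
Qed.

HB.instance Definition _ := isBiPointed.Build unit_itv itv_zero_one_neq.

Lemma zeroE : zero = itv_clamp 0 :> unit_itv. Proof. by []. Qed.
Lemma oneE : one = itv_clamp 1 :> unit_itv. Proof. by []. Qed.

Lemma coord_zero : itv_coord zero = 0.
Proof. by rewrite zeroE itv_clampK // lexx ler01. Qed.

Lemma coord_one : itv_coord one = 1.
Proof. by rewrite oneE itv_clampK // lexx ler01. Qed.

Lemma itv_coord_continuous : continuous itv_coord.
Proof. exact: initial_continuous. Qed.

Lemma itv_clamp_continuous : continuous itv_clamp.
Proof.
apply: continuous_comp_initial => r.
apply: (@continuous_max R R (cst 0)); first exact: cvg_cst.
by apply: (@continuous_min R R (cst 1)); [exact: cvg_cst|exact: cvg_id].
Qed.

End unit_itv.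

Section path_homotopy.
Variables (R : realType) (T : topologicalType).
Local Notation I := (unit_itv R).

Lemma paste_continuous (S : topologicalType) (h : S -> R) (c : R)
    (f g : S -> T) :
  continuous h -> continuous f -> continuous g ->
  (forall s, h s = c -> f s = g s) ->
  continuous (fun s => if h s <= c then f s else g s).
Proof.
move=> ch cf cg fg; set k := (fun s => if _ then _ else _) => s; rewrite /continuous_at.
have [hs|hs|hs] := ltgtP (h s) c.
- have -> : k s = f s by rewrite /k (ltW hs).
  apply: cvg_trans (cf s); apply: near_eq_cvg; near=> u; rewrite /k.
  suff -> : h u <= c by [].
  by apply/ltW; near: u; exact: (cvgr_lt (h s) (ch s)).
- have -> : k s = g s by rewrite /k leNgt hs.
  apply: cvg_trans (cg s); apply: near_eq_cvg; near=> u; rewrite /k.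
  suff : c < h u by rewrite leNgt => ->.
  by near: u; exact: (cvgr_gt (h s) (ch s)).
- have -> : k s = f s by rewrite /k hs lexx.
  move=> U fU.
  have gU : nbhs (g s) U by rewrite -fg.
  have fU' : nbhs s (f @^-1` U) := cf s U fU.
  have gU' : nbhs s (g @^-1` U) := cg s U gU.
  apply: filterS (filterI fU' gU') => u [/= fu gu].
  by rewrite /k; case: ifP.
Unshelve. all: by end_near. Qed.

Section ops.
Variables x y z : T.

Definition path_homotopic (f g : {path I from x to y}) : Prop :=
  exists H : I * I -> T,
    [/\ continuous H,
        forall t, H (t, zero) = f t,
        forall t, H (t, one) = g t,
        forall s, H (zero, s) = x &
        forall s, H (one, s) = y].

Definition path_concat_fun (f : {path I from x to y})
    (g : {path I from y to z}) (t : I) : T :=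
  if itv_coord t <= 2^-1 then f (itv_clamp (2 * itv_coord t))
  else g (itv_clamp (2 * itv_coord t - 1)).

Definition path_rev_fun (f : {path I from x to y}) (t : I) : T :=
  f (itv_clamp (1 - itv_coord t)).

Lemma comp_clamp_continuous (S : topologicalType) (U : topologicalType)
    (f : I -> U) (phi : S -> R) :
  continuous f -> continuous phi -> continuous (fun s => f (itv_clamp (phi s))).
Proof.
move=> cf cphi s.
apply: (@continuous_comp _ _ _ (fun s => itv_clamp (phi s))); last exact: cf.
apply: (@continuous_comp _ _ _ phi); first exact: cphi.
exact: itv_clamp_continuous.
Qed.

Lemma double_continuous (S : topologicalType) (phi : S -> R) :
  continuous phi -> continuous (fun s => 2 * phi s).
Proof. by move=> cphi s; apply: cvgMr; exact: cphi. Qed.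

Lemma double1_continuous (S : topologicalType) (phi : S -> R) :
  continuous phi -> continuous (fun s => 2 * phi s - 1).
Proof.
move=> cphi s; apply: cvgB; last exact: cvg_cst.
exact: double_continuous.
Qed.

Lemma rev_continuous (S : topologicalType) (phi : S -> R) :
  continuous phi -> continuous (fun s => 1 - phi s).
Proof.
by move=> cphi s; apply: cvgB; [exact: cvg_cst|exact: cphi].
Qed.

Lemma max_phi_continuous (S : topologicalType) (phi psi : S -> R) :
  continuous phi -> continuous psi ->
  continuous (fun s => Num.max (phi s) (psi s)).
Proof.
by move=> cphi cpsi s; apply: (@continuous_max R S phi psi);
  [exact: cphi|exact: cpsi].
Qed.

Lemma min_phi_continuous (S : topologicalType) (phi psi : S -> R) :
  continuous phi -> continuous psi ->
  continuous (fun s => Num.min (phi s) (psi s)).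
Proof.
by move=> cphi cpsi s; apply: (@continuous_min R S phi psi);
  [exact: cphi|exact: cpsi].
Qed.

Lemma cst_phi_continuous (S : topologicalType) (c : R) :
  continuous (fun _ : S => c).
Proof. by move=> s; exact: cvg_cst. Qed.

Lemma addc_continuous (S : topologicalType) (c : R) (phi : S -> R) :
  continuous phi -> continuous (fun s => phi s + c).
Proof.
by move=> cphi s; apply: cvgD; [exact: cphi|exact: cvg_cst].
Qed.

Lemma mulc_continuous (S : topologicalType) (c : R) (phi : S -> R) :
  continuous phi -> continuous (fun s => phi s * c).
Proof. by move=> cphi s; apply: cvgMl; exact: cphi. Qed.

Lemma path_concat_continuous f g : continuous (path_concat_fun f g).
Proof.
apply: (paste_continuous (@itv_coord_continuous R)).
- apply: comp_clamp_continuous; first exact: cts_fun.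
  exact/double_continuous/itv_coord_continuous.
- apply: comp_clamp_continuous; first exact: cts_fun.
  exact/double1_continuous/itv_coord_continuous.
- move=> t ->; rewrite divff // subrr -zeroE -oneE.
  by rewrite path_zero path_one.
Qed.

Lemma path_concat_zero f g : path_concat_fun f g zero = x.
Proof.
rewrite /path_concat_fun coord_zero invr_ge0 ler0n mulr0.
by rewrite -zeroE path_zero.
Qed.

Lemma path_concat_one f g : path_concat_fun f g one = z.
Proof.
rewrite /path_concat_fun coord_one ifF; last by apply/negbTE; rewrite -ltNge; lra.
by rewrite (_ : 2 * 1 - 1 = 1 :> R) -?oneE ?path_one //; ring.
Qed.

Lemma path_rev_continuous f : continuous (path_rev_fun f).
Proof.
apply: comp_clamp_continuous; first exact: cts_fun.
exact/rev_continuous/itv_coord_continuous.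
Qed.

Lemma path_rev_zero f : path_rev_fun f zero = y.
Proof. by rewrite /path_rev_fun coord_zero subr0 -oneE path_one. Qed.

Lemma path_rev_one f : path_rev_fun f one = x.
Proof. by rewrite /path_rev_fun coord_one subrr -zeroE path_zero. Qed.

Definition path_concat f g : {path I from x to z} :=
  mk_path (@path_concat_continuous f g) (path_concat_zero f g)
    (path_concat_one f g).

Definition path_rev f : {path I from y to x} :=
  mk_path (@path_rev_continuous f) (path_rev_zero f) (path_rev_one f).

Definition path_cst : {path I from x to x} := cst x.

End ops.

Section equivalence.
Variables x y : T.
Implicit Types f g h : {path I from x to y}.

Lemma fst_coord_continuous : continuous (fun p : I * I => itv_coord p.1).
Proof.
move=> p; apply: (@continuous_comp _ _ _ fst); first exact: cvg_fst.
exact: itv_coord_continuous.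
Qed.

Lemma snd_coord_continuous : continuous (fun p : I * I => itv_coord p.2).
Proof.
move=> p; apply: (@continuous_comp _ _ _ snd); first exact: cvg_snd.
exact: itv_coord_continuous.
Qed.

Lemma comp_pair_continuous (S A B C : topologicalType) (H : A * B -> C)
    (u : S -> A) (v : S -> B) :
  continuous H -> continuous u -> continuous v ->
  continuous (fun s => H (u s, v s)).
Proof.
move=> cH cu cv s; apply: (@continuous_comp _ _ _ (fun s => (u s, v s))).
  by apply: cvg_pair; [exact: cu|exact: cv].
exact: cH.
Qed.

Lemma fst_continuous' (A B : topologicalType) : continuous (@fst A B).
Proof. by move=> p; exact: cvg_fst. Qed.

Lemma snd_continuous' (A B : topologicalType) : continuous (@snd A B).
Proof. by move=> p; exact: cvg_snd. Qed.

Lemma path_homotopic_reparam f g (gamma : I -> T) (phi psi : I -> R) :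
  continuous gamma -> continuous phi -> continuous psi ->
  phi zero = psi zero -> phi one = psi one ->
  (forall t, f t = gamma (itv_clamp (phi t))) ->
  (forall t, g t = gamma (itv_clamp (psi t))) ->
  path_homotopic f g.
Proof.
move=> cgamma cphi cpsi pp0 pp1 fE gE.
exists (fun p => gamma (itv_clamp
  ((1 - itv_coord p.2) * phi p.1 + itv_coord p.2 * psi p.1))); split => /=.
- apply: comp_clamp_continuous => // p; apply: cvgD; apply: cvgM.
  + exact: (@rev_continuous _ _ (@snd_coord_continuous) p).
  + by apply: (@continuous_comp _ _ _ fst); [exact: cvg_fst|exact: cphi].
  + exact: (@snd_coord_continuous p).
  + by apply: (@continuous_comp _ _ _ fst); [exact: cvg_fst|exact: cpsi].
- by move=> t; rewrite coord_zero subr0 mul1r mul0r addr0 fE.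
- by move=> t; rewrite coord_one subrr mul0r mul1r add0r gE.
- move=> s; rewrite pp0 -mulrDl subrK mul1r -gE.
  exact: path_zero.
- move=> s; rewrite pp1 -mulrDl subrK mul1r -gE.
  exact: path_one.
Qed.

Lemma path_homotopic_refl f : path_homotopic f f.
Proof.
by apply: (@path_homotopic_reparam f f f (@itv_coord R) (@itv_coord R)) => //;
  [exact: cts_fun|exact: itv_coord_continuous|exact: itv_coord_continuous
  |move=> t; rewrite itv_coordK|move=> t; rewrite itv_coordK].
Qed.

Lemma path_homotopic_sym f g : path_homotopic f g -> path_homotopic g f.
Proof.
move=> [H [cH H0 H1 Hx Hy]].
exists (fun p => H (p.1, itv_clamp (1 - itv_coord p.2))); split => //=.
- apply: comp_pair_continuous => //; first exact: fst_continuous'.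
  apply: (@comp_clamp_continuous _ _ id); first by move=> ?; exact: cvg_id.
  exact/rev_continuous/snd_coord_continuous.
- by move=> t; rewrite coord_zero subr0 -oneE.
- by move=> t; rewrite coord_one subrr -zeroE.
Qed.

Lemma path_homotopic_trans g f h :
  path_homotopic f g -> path_homotopic g h -> path_homotopic f h.
Proof.
move=> [H [cH H0 H1 Hx Hy]] [K [cK K0 K1 Kx Ky]].
exists (fun p => if itv_coord p.2 <= 2^-1
  then H (p.1, itv_clamp (2 * itv_coord p.2))
  else K (p.1, itv_clamp (2 * itv_coord p.2 - 1))); split => //=.
- apply: (paste_continuous snd_coord_continuous).
  + apply: comp_pair_continuous => //; first exact: fst_continuous'.
    apply: (@comp_clamp_continuous _ _ id); first by move=> ?; exact: cvg_id.
    exact/double_continuous/snd_coord_continuous.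
  + apply: comp_pair_continuous => //; first exact: fst_continuous'.
    apply: (@comp_clamp_continuous _ _ id); first by move=> ?; exact: cvg_id.
    exact/double1_continuous/snd_coord_continuous.
  + by move=> [t s] /= ->; rewrite divff // subrr -oneE -zeroE H1 K0.
- by move=> t; rewrite coord_zero invr_ge0 ler0n mulr0 -zeroE H0.
- move=> t; rewrite coord_one ifF; last by apply/negbTE; rewrite -ltNge; lra.
  by rewrite (_ : 2 * 1 - 1 = 1 :> R) -?oneE ?K1 //; ring.
- by move=> s; case: ifP.
- by move=> s; case: ifP.
Qed.

End equivalence.

Lemma path_homotopic_concat (x y z : T) (f f' : {path I from x to y})
    (g g' : {path I from y to z}) :
  path_homotopic f f' -> path_homotopic g g' ->
  path_homotopic (path_concat f g) (path_concat f' g').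
Proof.
move=> [H [cH H0 H1 Hx Hy]] [K [cK K0 K1 Kx Ky]].
exists (fun p => if itv_coord p.1 <= 2^-1
  then H (itv_clamp (2 * itv_coord p.1), p.2)
  else K (itv_clamp (2 * itv_coord p.1 - 1), p.2)); split => /=.
- apply: (paste_continuous fst_coord_continuous).
  + apply: comp_pair_continuous => //; last exact: snd_continuous'.
    apply: (@comp_clamp_continuous _ _ id); first by move=> ?; exact: cvg_id.
    exact/double_continuous/fst_coord_continuous.
  + apply: comp_pair_continuous => //; last exact: snd_continuous'.
    apply: (@comp_clamp_continuous _ _ id); first by move=> ?; exact: cvg_id.
    exact/double1_continuous/fst_coord_continuous.
  + by move=> [t s] /= ->; rewrite divff // subrr -oneE -zeroE Hy Kx.
- by move=> t; rewrite /mk_path /path_concat_fun H0 K0.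
- by move=> t; rewrite /mk_path /path_concat_fun H1 K1.
- by move=> s; rewrite coord_zero invr_ge0 ler0n mulr0 -zeroE Hx.
- move=> s; rewrite coord_one ifF; last by apply/negbTE; rewrite -ltNge; lra.
  by rewrite (_ : 2 * 1 - 1 = 1 :> R) -?oneE ?Ky //; ring.
Qed.

Lemma path_homotopic_rev (x y : T) (f f' : {path I from x to y}) :
  path_homotopic f f' -> path_homotopic (path_rev f) (path_rev f').
Proof.
move=> [H [cH H0 H1 Hx Hy]].
exists (fun p => H (itv_clamp (1 - itv_coord p.1), p.2)); split => /=.
- apply: comp_pair_continuous => //; last exact: snd_continuous'.
  apply: (@comp_clamp_continuous _ _ id); first by move=> ?; exact: cvg_id.
  exact/rev_continuous/fst_coord_continuous.
- by move=> t; rewrite H0.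
- by move=> t; rewrite H1.
- by move=> s; rewrite coord_zero subr0 -oneE.
- by move=> s; rewrite coord_one subrr -zeroE.
Qed.

Lemma path_concatA (x y z w : T) (f : {path I from x to y})
    (g : {path I from y to z}) (h : {path I from z to w}) :
  path_homotopic (path_concat f (path_concat g h))
                 (path_concat (path_concat f g) h).
Proof.
pose phi (t : I) : R := Num.min (2 * itv_coord t)
  (Num.min (itv_coord t + 4^-1) ((itv_coord t + 1) / 2)).
have cI := @itv_coord_continuous R.
apply: (@path_homotopic_reparam _ _ _ _ (path_concat f (path_concat g h))
  (@itv_coord R) phi) => //.
- exact: cts_fun.
- have c4 := @addc_continuous _ (4^-1) _ cI.
  have c2 : continuous (fun t : I => (itv_coord t + 1) / 2).
    exact: (@mulc_continuous _ _ _ (@addc_continuous _ 1 _ cI)).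
  apply: min_phi_continuous; first exact: double_continuous.
  exact: min_phi_continuous.
- rewrite /phi coord_zero; case: (leP (0 + 4^-1 : R)) => ?;
  case: (leP (2 * 0 : R)) => ?; lra.
- rewrite /phi coord_one; case: (leP (1 + 4^-1 : R)) => ?;
  case: (leP (2 * 1 : R)) => ?; lra.
- by move=> t; rewrite itv_coordK.
move=> t; have t0 := itv_coord_ge0 t; have t1 := itv_coord_le1 t.
have phi_lo : itv_coord t <= 4^-1 -> phi t = 2 * itv_coord t.
  by move=> ?; rewrite /phi min_l // le_min; apply/andP; split; lra.
have phi_mid : 4^-1 <= itv_coord t <= 2^-1 -> phi t = itv_coord t + 4^-1.
  move=> /andP[? ?]; rewrite /phi (@min_l _ _ (itv_coord t + 4^-1)); last lra.
  by rewrite min_r //; lra.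
have phi_hi : 2^-1 <= itv_coord t -> phi t = (itv_coord t + 1) / 2.
  move=> ?; rewrite /phi (@min_r _ _ (itv_coord t + 4^-1)); last lra.
  by rewrite min_r //; lra.
rewrite /= /mk_path /path_concat_fun /= /mk_path /path_concat_fun.
have ifF' (r : R) : 2^-1 < r -> (r <= 2^-1) = false.
  by move=> r2; apply/negbTE; rewrite -ltNge.
have [t4|t4] := leP (itv_coord t) 4^-1.
  rewrite phi_lo // (@itv_clampK _ (2 * itv_coord t));
    last by apply/andP; split; lra.
  have -> : itv_coord t <= 2^-1 by lra.
  by have -> : 2 * itv_coord t <= 2^-1 by lra.
have [t2|t2] := leP (itv_coord t) 2^-1.
  rewrite phi_mid ?(ltW t4) // (@itv_clampK _ (2 * itv_coord t));
    last by apply/andP; split; lra.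
  rewrite (@itv_clampK _ (_ + _)); last by apply/andP; split; lra.
  rewrite (@itv_clampK _ (_ - 1)); last by apply/andP; split; lra.
  rewrite (ifF' (2 * itv_coord t)); last lra.
  rewrite (ifF' (itv_coord t + 4^-1)); last lra.
  have -> : 2 * (itv_coord t + 4^-1) - 1 <= 2^-1 by lra.
  by congr (g (itv_clamp _)); lra.
rewrite phi_hi ?(ltW t2) // (@itv_clampK _ (_ / _));
  last by apply/andP; split; lra.
rewrite (@itv_clampK _ (2 * (_ / _) - 1)); last by apply/andP; split; lra.
rewrite (ifF' (_ / _)); last lra.
by rewrite (ifF' (_ - 1)); [congr (h (itv_clamp _))|]; lra.
Qed.

Lemma path_concat_cst_l (x y : T) (f : {path I from x to y}) :
  path_homotopic (path_concat (path_cst x) f) f.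
Proof.
apply: (@path_homotopic_reparam _ _ _ _ f
  (fun t => Num.max 0 (2 * itv_coord t - 1)) (@itv_coord R)) => //.
- exact: cts_fun.
- apply: max_phi_continuous; first exact: cst_phi_continuous.
  exact/double1_continuous/itv_coord_continuous.
- exact: itv_coord_continuous.
- by rewrite coord_zero max_l //; lra.
- by rewrite coord_one max_r //; lra.
- move=> t; rewrite /= /mk_path /path_concat_fun /=; case: leP => t2.
    by rewrite max_l -?zeroE ?path_zero //; lra.
  by rewrite max_r //; lra.
- by move=> t; rewrite itv_coordK.
Qed.

Lemma path_concat_cst_r (x y : T) (f : {path I from x to y}) :
  path_homotopic (path_concat f (path_cst y)) f.
Proof.
apply: (@path_homotopic_reparam _ _ _ _ f
  (fun t => Num.min 1 (2 * itv_coord t)) (@itv_coord R)) => //.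
- exact: cts_fun.
- apply: min_phi_continuous; first exact: cst_phi_continuous.
  exact/double_continuous/itv_coord_continuous.
- exact: itv_coord_continuous.
- by rewrite coord_zero min_r //; lra.
- by rewrite coord_one min_l //; lra.
- move=> t; rewrite /= /mk_path /path_concat_fun /=; case: leP => t2.
    by rewrite min_r //; lra.
  by rewrite min_l -?oneE ?path_one //; lra.
- by move=> t; rewrite itv_coordK.
Qed.

Lemma path_concat_rev_l (x y : T) (f : {path I from x to y}) :
  path_homotopic (path_concat (path_rev f) f) (path_cst y).
Proof.
apply: (@path_homotopic_reparam _ _ _ _ f
  (fun t => Num.max (1 - 2 * itv_coord t) (2 * itv_coord t - 1))
  (cst 1)) => //.
- exact: cts_fun.
- apply: max_phi_continuous.
    exact/rev_continuous/double_continuous/itv_coord_continuous.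
  exact/double1_continuous/itv_coord_continuous.
- exact: cst_phi_continuous.
- by rewrite coord_zero max_l //=; lra.
- by rewrite coord_one max_r //=; lra.
- move=> t; have t0 := itv_coord_ge0 t.
  rewrite /= /mk_path /path_concat_fun /= /mk_path /path_rev_fun.
  case: leP => t2; last by rewrite max_r //; lra.
  rewrite max_l; last lra.
  by rewrite itv_clampK //; apply/andP; split; lra.
- by move=> t; rewrite /= -oneE path_one.
Qed.

Lemma path_concat_rev_r (x y : T) (f : {path I from x to y}) :
  path_homotopic (path_concat f (path_rev f)) (path_cst x).
Proof.
apply: (@path_homotopic_reparam _ _ _ _ f
  (fun t => Num.min (2 * itv_coord t) (1 - (2 * itv_coord t - 1)))
  (cst 0)) => //.
- exact: cts_fun.
- apply: min_phi_continuous.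
    exact/double_continuous/itv_coord_continuous.
  exact/rev_continuous/double1_continuous/itv_coord_continuous.
- exact: cst_phi_continuous.
- by rewrite coord_zero min_l //=; lra.
- by rewrite coord_one min_r //=; lra.
- move=> t; have t1 := itv_coord_le1 t.
  rewrite /= /mk_path /path_concat_fun /= /mk_path /path_rev_fun.
  case: leP => t2; first by rewrite min_l //; lra.
  rewrite min_r; last lra.
  by rewrite itv_clampK //; apply/andP; split; lra.
- by move=> t; rewrite /= -zeroE path_zero.
Qed.

(* Homotopies fix the endpoints: a loop is nulhomotopic when its class in the
   fundamental group at its own base point is trivial. *)
Definition nulhomotopic (x : T) (f : {path I from x to x}) : Prop :=
  path_homotopic f (path_cst x).

End path_homotopy.

Section fundamental_group.
Variables (R : realType) (T : topologicalType) (x : T).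
Local Notation loop := {path (unit_itv R) from x to x}.

Definition loop_homotopic (f g : loop) : bool := `[< path_homotopic f g >].

Lemma loop_homotopic_refl : reflexive loop_homotopic.
Proof. by move=> f; apply/asboolP; exact: path_homotopic_refl. Qed.

Lemma loop_homotopic_sym : symmetric loop_homotopic.
Proof.
by move=> f g; apply/asboolP/asboolP; exact: path_homotopic_sym.
Qed.

Lemma loop_homotopic_trans : transitive loop_homotopic.
Proof.
move=> g f h /asboolP fg /asboolP gh; apply/asboolP.
exact: path_homotopic_trans fg gh.
Qed.

Definition loop_homotopic_equiv : equiv_rel loop :=
  EquivRel loop_homotopic loop_homotopic_refl loop_homotopic_sym
    loop_homotopic_trans.

Definition pi1 : Type := {eq_quot loop_homotopic_equiv}.

HB.instance Definition _ := Choice.on pi1.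
HB.instance Definition _ := EqQuotient.on pi1.

Definition pi1_class (f : loop) : pi1 := \pi_pi1 f.

Lemma pi1_classP (f g : loop) :
  pi1_class f = pi1_class g <-> path_homotopic f g.
Proof.
rewrite /pi1_class; split=> [/eqmodP/asboolP //|fg].
by apply/eqmodP/asboolP.
Qed.

Lemma pi1_class_repr (a : pi1) : pi1_class (repr a) = a.
Proof. exact: reprK. Qed.

Definition pi1_one : pi1 := pi1_class (path_cst R x).
Definition pi1_inv (a : pi1) : pi1 := pi1_class (path_rev (repr a)).
Definition pi1_mul (a b : pi1) : pi1 :=
  pi1_class (path_concat (repr a) (repr b)).

Lemma pi1_inv_class f : pi1_inv (pi1_class f) = pi1_class (path_rev f).
Proof.
apply/pi1_classP/path_homotopic_rev.
by apply/pi1_classP; rewrite pi1_class_repr.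
Qed.

Lemma pi1_mul_class f g :
  pi1_mul (pi1_class f) (pi1_class g) = pi1_class (path_concat f g).
Proof.
by apply/pi1_classP/path_homotopic_concat;
  apply/pi1_classP; rewrite pi1_class_repr.
Qed.

Lemma pi1_mulA : associative pi1_mul.
Proof.
move=> a b c; rewrite -(pi1_class_repr a) -(pi1_class_repr b).
rewrite -(pi1_class_repr c) !pi1_mul_class.
exact/pi1_classP/path_concatA.
Qed.

Lemma pi1_mul1 : left_id pi1_one pi1_mul.
Proof.
move=> a; rewrite -(pi1_class_repr a) pi1_mul_class.
exact/pi1_classP/path_concat_cst_l.
Qed.

Lemma pi1_mulr1 : right_id pi1_one pi1_mul.
Proof.
move=> a; rewrite -(pi1_class_repr a) pi1_mul_class.
exact/pi1_classP/path_concat_cst_r.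
Qed.

Lemma pi1_mulV : left_inverse pi1_one pi1_inv pi1_mul.
Proof.
move=> a; rewrite -(pi1_class_repr a) pi1_inv_class pi1_mul_class.
exact/pi1_classP/path_concat_rev_l.
Qed.

Lemma pi1_mulrV : right_inverse pi1_one pi1_inv pi1_mul.
Proof.
move=> a; rewrite -(pi1_class_repr a) pi1_inv_class pi1_mul_class.
exact/pi1_classP/path_concat_rev_r.
Qed.

HB.instance Definition _ :=
  isGroup.Build pi1 pi1_mulA pi1_mul1 pi1_mulr1 pi1_mulV pi1_mulrV.

End fundamental_group.

Definition isomorphic_groups (G H : groupType) : Prop :=
  exists f : {multiplicative G -> H}, bijective f.

(* Distances between and lengths of sets and paths take values in \bar R, so
   that infinite suprema and infima are +oo. *)
Section metric_notions.
Variable R : realType.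
Local Open Scope ereal_scope.

Definition diameter (X : metricType R) (A : set X) : \bar R :=
  ereal_sup [set (mdist p.1 p.2)%:E | p in A `*` A].

Definition dist_to_set (Z : metricType R) (z : Z) (A : set Z) : \bar R :=
  ereal_inf [set (mdist z a)%:E | a in A].

Definition hausdorff_dist (Z : metricType R) (A B : set Z) : \bar R :=
  maxe (ereal_sup [set dist_to_set a B | a in A])
       (ereal_sup [set dist_to_set b A | b in B]).

Definition isometric_to_subspace (X Z : metricType R) (A : set Z) : Prop :=
  exists2 f : X -> Z,
    set_bij [set: X] A f & forall x y, mdist (f x) (f y) = mdist x y.

Definition gromov_hausdorff_dist (X Y : metricType R) : \bar R :=
  ereal_inf [set d | exists (Z : metricType R) (X' Y' : set Z),
    [/\ isometric_to_subspace X X', isometric_to_subspace Y Y' &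
        d = hausdorff_dist X' Y']].

(* Subdivisions zero = t 0 <= ... <= t n = one of [0, 1]. *)
Definition path_length (X : metricType R) (gamma : unit_itv R -> X) : \bar R :=
  ereal_sup [set l | exists (n : nat) (t : nat -> unit_itv R),
    [/\ t 0%N = zero, t n = one,
        {homo (fun i => itv_coord (t i)) : i j / (i <= j)%N >-> (i <= j)%R} &
        l = (\sum_(i < n) mdist (gamma (t i)) (gamma (t i.+1)))%:E]].

Definition length_space (X : metricType R) : Prop :=
  forall x y : X, (mdist x y)%:E =
    ereal_inf (range (fun gamma : {path (unit_itv R) from x to y} =>
      path_length gamma)).

End metric_notions.

(* Main.v *)
Require Import Defs.
From HB Require Import structures.
From Corelib Require Setoid.
From mathcomp Require Import all_boot all_order all_algebra.
From mathcomp Require Import all_classical all_reals all_analysis homotopy.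
From mathcomp Require Import ring lra zify.
Set Implicit Arguments.
Unset Strict Implicit.
Unset Printing Implicit Defensive.
Import Order.TTheory GRing.Theory Num.Theory.
Import numFieldNormedType.Exports.
Local Open Scope classical_set_scope.
Local Open Scope ring_scope.

(** Choose r < D with Hausdorff distance below r in a common ambient space, and
maps psi : X -> Y and chi : Y -> X moving each point by less than r there.  They
distort distances by at most 2r but need not be continuous, so they do not act
on loops.  They do act on finely sampled loops: replace the samples by their
images and join consecutive images by almost shortest paths.  The result is
well defined up to homotopy because every triangle made of three paths of total
length less than 8D has diameter less than 4D, hence is nulhomotopic.

To organize this without bookkeeping of endpoints, all base points are tethered.
Fix almost shortest paths e x x' in X; conjugating by the paths e x0 x turns each
path of X, whatever its endpoints, into an element of pi1(X, x0) ([tclass]), and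
in particular gives elements w(x, x') of pi1(X, x0) ([edge_class]).  They satisfy
w(x, y) w(y, z) = w(x, z) as soon as the triangle x y z has perimeter a little
less than 8D ([edge_class_triangle]), and the class of a loop is the product of
the w's along any fine enough sampling of it ([tclass_edges]).

Conversely, let v be any group-valued function of pairs of points such that
v(a, b) v(b, c) = v(a, c) on small triangles ([local_cocycle]).  The product of
v along the samples of a path stabilizes as the sampling gets finer; the limit
([holonomy]) is multiplicative and invariant under homotopy, so it gives a
homomorphism on pi1 ([transfer]).  Since 6r < 8D, pulling back the w's of Y along
psi gives such a v on X, hence a homomorphism pi1(X) -> pi1(Y), and symmetrically
a homomorphism back.

The composite pi1(X) -> pi1(Y) -> pi1(X) is a conjugation
([transfer_round_trip]).  Take consecutive samples x, x' of a loop in X.  The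
path joining psi x to psi x' has length little more than 2r, so every point z of
it is within little more than r of one of its ends, and chi z is within little
more than 3r of x.  Coning the points chi z off from x produces triangles with
sides about 3r, 3r and 2r; their perimeter is about 8r < 8D, so the cone is
trivial and the composite sends w(x, x') to its product with correction terms
depending on x and on x' separately, which telescope along the loop.  By symmetry
the other composite is a conjugation too, and the homomorphisms are bijective. *)

(** * Products along a ladder *)

(** Both ways of comparing products of samples are instances of this: along a
homotopy, [g i] is a rung between two neighbouring paths, and along one path it
is a change of gauge at the i-th sample. *)
Lemma prod_ladder (G : groupType) (p q g : nat -> G) n :
  (forall i, (i < n)%N -> p i * g i.+1 = g i * q i)%g ->
  ((\prod_(i < n) p i) * g n = g 0%N * \prod_(i < n) q i)%g.
Proof.
elim: n => [|n IH] h; first by rewrite !big_ord0 mul1g mulg1.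
rewrite !big_ord_recr /= -mulgA h // !mulgA IH // => i ni.
by apply: h; rewrite ltnS ltnW.
Qed.

Lemma prod_telescope (G : groupType) (p g : nat -> G) n :
  (forall i, (i < n)%N -> p i * g i.+1 = g i)%g ->
  ((\prod_(i < n) p i) * g n = g 0%N)%g.
Proof.
move=> h; rewrite (prod_ladder (q := fun=> 1%g)) ?big1 ?mulg1 // => i ni.
by rewrite mulg1 h.
Qed.

(** * Uniform continuity on the unit interval and square *)

Section uniform.
Variables (R : realType) (Z : metricType R).
Local Notation I := (unit_itv R).

Lemma itv_clamp_lip (s t : R) :
  `|itv_coord (itv_clamp s) - itv_coord (itv_clamp t)| <= `|s - t|.
Proof.
rewrite !itv_clampE ler_norml.
have h1 := ler_norm (s - t); have := ler_norm (t - s); rewrite distrC => h2.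
apply/andP; split; case: (leP 1 s) => ?; case: (leP 1 t) => ?;
  rewrite /Num.max; do ![case: ifPn; rewrite -?leNgt => ?]; lra.
Qed.

(** The mesh is expressed by a number of subdivisions, which is what samplings
provide. *)
Lemma square_unif_continuous (H : I * I -> Z) (eta : R) :
  continuous H -> 0 < eta ->
  exists N, (0 < N)%N /\ forall n (s s' t t' : R), (N <= n)%N ->
    `|s - s'| <= n%:R^-1 -> `|t - t'| <= n%:R^-1 ->
    mdist (H (itv_clamp s, itv_clamp t)) (H (itv_clamp s', itv_clamp t')) < eta.
Proof.
move=> cH eta0.
(* The square is extended to the plane by clamping, where the metric and
  the compactness of segments are available. *)
pose K (p : R * R) := H (itv_clamp p.1, itv_clamp p.2).
have cK : continuous K.
  apply: comp_pair_continuous => // p.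
    apply: (@continuous_comp _ _ _ fst); first exact: cvg_fst.
    exact: itv_clamp_continuous.
  apply: (@continuous_comp _ _ _ snd); first exact: cvg_snd.
  exact: itv_clamp_continuous.
have cI : compact (`[0, 1]%classic `*` `[0, 1]%classic : set (R * R)).
  by apply: compact_setX; exact: segment_compact.
have /compact_near_coveringP/(_ R (at_right 0)
  (fun d p => forall q, ball p d q -> mdist (K p) (K q) < eta)) := cI.
case=> [p _|d d0 h].
  have : \forall q \near p, mdist (K p) (K q) < eta / 2.
    have := cK p (ball (K p) (eta / 2)).
    rewrite ballEmdist; apply; rewrite -ballEmdist; apply: nbhsx_ballx.
    by rewrite divr_gt0.
  move=> /nbhs_ballP[r /= r0 rK].
  exists (ball p (r / 2), [set d : R | d < r / 2]).
    by split => /=; [apply: nbhsx_ballx|apply: nbhs_right_lt]; rewrite divr_gt0.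
  move=> [q d] /= [pq dr] q' qq'.
  have hq : mdist (K p) (K q) < eta / 2.
    by apply: rK; apply: le_ball pq; rewrite ler_pdivrMr // ler_peMr ?ltW //; lra.
  have hq' : mdist (K p) (K q') < eta / 2.
    apply: rK; rewrite [r]splitr; apply: ball_triangle pq _.
    by apply: le_ball qq'; exact: ltW.
  rewrite metric_sym in hq.
  apply: le_lt_trans (metric_triangle _ (K p) _) _; lra.
have d20 : 0 < d / 2 by rewrite divr_gt0.
pose N := (Num.truncn (d / 2)^-1).+1.
exists N; split => // n s s' t t' Nn ss' tt'.
have nd : (n%:R^-1 : R) < d / 2.
  rewrite invf_plt ?posrE ?ltr0n ?(leq_trans _ Nn) //.
  by apply: lt_le_trans (truncnS_gt _) _; rewrite ler_nat.
have he := h (d / 2) _ d20.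
(* The covering argument only bounds [K] near points of the unit square, so
  return to clamped coordinates, which the clamp does not move apart. *)
have cc (r : R) : itv_clamp (itv_coord (itv_clamp r)) = itv_clamp r.
  exact: itv_coordK.
have := he _ (itv_coord (itv_clamp s), itv_coord (itv_clamp t)) _
  (itv_coord (itv_clamp s'), itv_coord (itv_clamp t')).
rewrite /K /= !cc; apply.
  by rewrite /= sub0r normrN gtr0_norm // ltr_pdivrMr // ltr_pMr //; lra.
  by split; rewrite /= in_itv /= itv_coord_ge0 itv_coord_le1.
by split; rewrite /ball /= /ball_ /=;
  apply: le_lt_trans (itv_clamp_lip _ _) _; apply: le_lt_trans nd.
Qed.

Lemma path_unif_continuous (f : I -> Z) (eta : R) :
  continuous f -> 0 < eta ->
  exists N, (0 < N)%N /\ forall n (s t : R), (N <= n)%N ->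
    `|s - t| <= n%:R^-1 -> mdist (f (itv_clamp s)) (f (itv_clamp t)) < eta.
Proof.
move=> cf eta0; have cf1 : continuous (fun p : I * I => f p.1).
  move=> p; apply: (@continuous_comp _ _ _ fst); first exact: cvg_fst.
  exact: cf.
have [N [N0 hN]] := square_unif_continuous cf1 eta0.
by exists N; split => // n s t Nn st; apply: (hN n s t s t).
Qed.
End uniform.

(** * Holonomy of local cocycles *)

Section holonomy.
Variables (R : realType) (Z : metricType R) (G : groupType).
Local Notation I := (unit_itv R).

(** This says that [v] is a Cech 1-cocycle on pairs of points closer than [eta],
that is, a flat connection seen at scale [eta]. *)
Definition local_cocycle (v : Z -> Z -> G) (eta : R) : Prop :=
  forall a b c, mdist a b < eta -> mdist b c < eta -> mdist a c < eta ->
    (v a b * v b c = v a c)%g.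

Variable v : Z -> Z -> G.

Definition grid n i : I := itv_clamp (i%:R / n%:R).

Definition chain_prod (c : nat -> Z) n : G := (\prod_(i < n) v (c i) (c i.+1))%g.

(** The eventual value of the products over the regular samplings of [f]; the
default value 1 matters only when they do not stabilize. *)
Definition holonomy (f : I -> Z) : G :=
  xget 1%g [set h | exists N, forall n, (N <= n)%N ->
    chain_prod (f \o grid n) n = h].

Lemma grid_start n : grid n 0 = zero. Proof. by rewrite /grid mul0r zeroE. Qed.

(** Clamping makes a sampling continue with its last point, so that samplings
with different numbers of points can be compared index by index. *)
Lemma grid_end n i : (0 < n <= i)%N -> grid n i = one.
Proof.
move=> /andP[n0 ni]; rewrite /grid oneE itv_clamp_ge1 //.
by rewrite ler_pdivlMr ?ltr0n // mul1r ler_nat.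
Qed.

Variable eta : R.
Hypothesis eta0 : 0 < eta.
Hypothesis v_local : local_cocycle v eta.

Lemma v_refl a : v a a = 1%g.
Proof.
by apply: (@mulgI G (v a a)); rewrite mulg1 v_local // mdistxx.
Qed.

(** Each square between two neighbouring chains is cut by a diagonal into two
triangles, on both of which [v] is multiplicative. *)
Lemma chain_prod_ladder (c c' : nat -> Z) n :
  (forall i j, (i <= n)%N -> (j <= n)%N -> (i <= j <= i.+1)%N ->
     [/\ mdist (c i) (c j) < eta, mdist (c' i) (c' j) < eta &
         mdist (c i) (c' j) < eta]) ->
  (chain_prod c n * v (c n) (c' n) = v (c 0%N) (c' 0%N) * chain_prod c' n)%g.
Proof.
move=> h; apply: (@prod_ladder G (fun i => v (c i) (c i.+1))
  (fun i => v (c' i) (c' i.+1)) (fun i => v (c i) (c' i))) => i ni.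
have [h1 h2 h3] : [/\ mdist (c i) (c i.+1) < eta, mdist (c' i) (c' i.+1) < eta &
  mdist (c i) (c' i.+1) < eta] by apply: h; rewrite ?leqnSn ?leqnn // ltnW.
have [_ _ h4] : [/\ mdist (c i) (c i) < eta, mdist (c' i) (c' i) < eta &
  mdist (c i) (c' i) < eta] by apply: h; rewrite ?leqnSn ?leqnn // ltnW.
have [_ _ h5] : [/\ mdist (c i.+1) (c i.+1) < eta,
  mdist (c' i.+1) (c' i.+1) < eta &
  mdist (c i.+1) (c' i.+1) < eta] by apply: h; rewrite ?leqnSn ?leqnn.
by rewrite !v_local.
Qed.

Lemma grid_step n i j : (i <= j <= i.+1)%N ->
  `|i%:R / n%:R - j%:R / n%:R| <= n%:R^-1 :> R.
Proof.
move=> /andP[ij ji]; rewrite -mulrBl normrM [X in _ * X]ger0_norm ?invr_ge0 //.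
rewrite ler_piMl ?invr_ge0 // distrC ger0_norm ?subr_ge0 ?ler_nat //.
by rewrite lerBlDr nat1r ler_nat.
Qed.

(** The samplings with n and n + 1 subdivisions are neighbouring chains; comparing
them successively avoids common refinements. *)
Lemma grid_refine n i j : (i <= n.+1)%N -> (i <= j <= i.+1)%N -> (0 < n)%N ->
  `|i%:R / n%:R - j%:R / n.+1%:R| <= n%:R^-1 :> R.
Proof.
move=> ni /andP[ij ji] n0.
have n0' : (0 : R) < n%:R by rewrite ltr0n.
have n1' : (0 : R) < n.+1%:R by rewrite ltr0n.
have -> : i%:R / n%:R - j%:R / n.+1%:R =
    (i%:R * n.+1%:R - j%:R * n%:R) / (n%:R * n.+1%:R) :> R.
  by field; rewrite !lt0r_neq0.
rewrite normrM normfV [X in _ / X]gtr0_norm ?mulr_gt0 //.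
rewrite ler_pdivrMr ?mulr_gt0 // mulKf ?lt0r_neq0 //.
have iR : (i%:R : R) <= n.+1%:R by rewrite ler_nat.
have i0 : (0 : R) <= i%:R by [].
have [->|->] : j = i \/ j = i.+1 by lia.
  by rewrite ler_norml -!natr1 in iR *; nra.
by rewrite ler_norml -!natr1 in iR *; apply/andP; split; nra.
Qed.

Lemma holonomyP (f : I -> Z) : continuous f ->
  exists N, forall n, (N <= n)%N -> chain_prod (f \o grid n) n = holonomy f.
Proof.
move=> cf; have [N [N0 hN]] := path_unif_continuous cf eta0.
have step n : (N <= n)%N ->
    chain_prod (f \o grid n) n = chain_prod (f \o grid n.+1) n.+1.
  move=> Nn; have n0 : (0 < n)%N by apply: leq_trans Nn.
  have SNn : (N <= n.+1)%N by apply: leqW.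
  transitivity (chain_prod (f \o grid n) n.+1).
    rewrite /chain_prod big_ord_recr /= !grid_end ?n0 ?leqnn ?leqnSn //.
    by rewrite v_refl mulg1.
  have := @chain_prod_ladder (f \o grid n) (f \o grid n.+1) n.+1.
  rewrite /= !grid_start !grid_end ?n0 ?leqnn ?leqnSn // !v_refl mul1g mulg1.
  apply=> i j ni nj ij; split.
  - exact/(hN _ _ _ Nn)/grid_step.
  - exact/(hN _ _ _ SNn)/grid_step.
  - exact/(hN _ _ _ Nn)/grid_refine.
have const n : (N <= n)%N ->
    chain_prod (f \o grid n) n = chain_prod (f \o grid N) N.
  elim: n => [|n IH]; first by rewrite leqn0 => /eqP ->.
  by rewrite leq_eqVlt ltnS => /predU1P[-> //|/[dup] /IH <- /step ->].
rewrite /holonomy; set P := [set h | _].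
have : P (xget 1%g P).
  by apply: xgetPex; exists (chain_prod (f \o grid N) N), N.
by [].
Qed.

Lemma holonomy_eventually (f : I -> Z) h : continuous f ->
  (exists N, forall n, (N <= n)%N -> chain_prod (f \o grid n) n = h) ->
  holonomy f = h.
Proof.
move=> /holonomyP[N hN] [M hM].
by rewrite -(hN _ (leq_maxl N M)) (hM _ (leq_maxr N M)).
Qed.

Lemma holonomy_cst a : holonomy (cst a) = 1%g.
Proof.
apply: holonomy_eventually; first exact: cst_continuous.
by exists 0%N => n _; rewrite /chain_prod big1 // => i _; rewrite v_refl.
Qed.

(** The rows of a fine subdivision of the square of the homotopy are neighbouring
chains, whose outer rungs are trivial because the endpoints are fixed. *)
Lemma holonomy_homotopic x y (f g : {path I from x to y}) :
  path_homotopic f g -> holonomy f = holonomy g.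
Proof.
move=> [H [cH Hf Hg Hx Hy]].
have [N [N0 hN]] := square_unif_continuous cH eta0.
have [M1 h1] := holonomyP (@cts_fun _ _ f).
have [M2 h2] := holonomyP (@cts_fun _ _ g).
pose n := maxn N (maxn M1 M2).
have Nn : (N <= n)%N by rewrite leq_max leqnn.
have n0 : (0 < n)%N by apply: leq_trans Nn.
rewrite -(h1 n) ?leq_max ?leqnn ?orbT // -(h2 n) ?leq_max ?leqnn ?orbT //.
pose row j i := H (grid n i, grid n j).
have row0 : row 0%N = f \o grid n by apply/funext => i; rewrite /row grid_start Hf.
have rown : row n = g \o grid n.
  by apply/funext => i; rewrite /row [grid n n]grid_end ?n0 ?leqnn // Hg.
rewrite -row0 -rown.
have step j : chain_prod (row j) n = chain_prod (row j.+1) n.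
  have := @chain_prod_ladder (row j) (row j.+1) n.
  rewrite /row /= !grid_start ![grid n n]grid_end ?n0 ?leqnn // !Hx !Hy.
  rewrite !v_refl mul1g mulg1; apply=> i k ni nk ik.
  by split; apply: (hN _ _ _ _ _ Nn); apply: grid_step; rewrite ?ik ?leqnn ?leqnSn.
by elim: {2}n => // k ->.
Qed.

(** Sampling the concatenation at 2n subdivisions samples each factor at n. *)
Lemma holonomy_concat x y z (f : {path I from x to y})
    (g : {path I from y to z}) :
  holonomy (path_concat f g) = (holonomy f * holonomy g)%g.
Proof.
have [M1 h1] := holonomyP (@cts_fun _ _ f).
have [M2 h2] := holonomyP (@cts_fun _ _ g).
have [M3 h3] := holonomyP (@cts_fun _ _ (path_concat f g)).
have [n [nP n1 n2 n3]] : exists n, [/\ (0 < n)%N, (M1 <= n)%N, (M2 <= n)%N &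
    (M3 <= n + n)%N].
  by exists (maxn M1 (maxn M2 M3)).+1; split=> //; lia.
have n0 : (0 : R) < n%:R by rewrite ltr0n.
rewrite -(h1 n) // -(h2 n) // -(h3 (n + n)%N) //.
have gridD i : (i <= n + n)%N -> itv_coord (grid (n + n) i) = i%:R / n%:R / 2.
  move=> ni; rewrite itv_clampK.
    by rewrite natrD; field; rewrite !lt0r_neq0 ?addr_gt0.
  by rewrite divr_ge0 //= ler_pdivrMr ?mul1r ?ler_nat // ltr0n addn_gt0 nP.
have first i : (i <= n)%N -> path_concat f g (grid (n + n) i) = f (grid n i).
  move=> ni; rewrite /= /mk_path /path_concat_fun gridD; last first.
    exact: leq_trans (leq_addr _ _).
  rewrite ler_pdivrMr // mulVf // ler_pdivrMr // mul1r ler_nat ni.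
  by congr (f (itv_clamp _)); field; rewrite lt0r_neq0.
have second i : (i <= n)%N ->
    path_concat f g (grid (n + n) (n + i)) = g (grid n i).
  move=> ni; have [->|i0] := posnP i.
    by rewrite addn0 first // grid_start grid_end ?nP ?leqnn // path_one path_zero.
  rewrite /= /mk_path /path_concat_fun gridD ?leq_add2l //.
  rewrite ler_pdivrMr // mulVf // ler_pdivrMr // mul1r ler_nat.
  rewrite -[X in (_ <= X)%N]addn0 leq_add2l leqNgt i0 /=.
  by congr (g (itv_clamp _)); rewrite natrD; field; rewrite lt0r_neq0.
rewrite /chain_prod big_split_ord /=; congr (_ * _)%g; apply: eq_bigr => i _ /=.
  by rewrite !first // ltnW.
by rewrite -addnS !second // ltnW.
Qed.

Lemma holonomy_rev x y (f : {path I from x to y}) :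
  holonomy (path_rev f) = (holonomy f)^-1%g.
Proof.
apply: (@mulgI G (holonomy f)); rewrite mulgV -holonomy_concat.
by rewrite (holonomy_homotopic (path_concat_rev_r f)) holonomy_cst.
Qed.
End holonomy.

(** * Tethered classes of paths *)

#[local] Instance path_homotopic_equivalence (R : realType)
    (T : topologicalType) (x y : T) :
  RelationClasses.Equivalence (@path_homotopic R T x y).
Proof.
split; [exact: path_homotopic_refl|exact: path_homotopic_sym|].
by move=> f g h; exact: path_homotopic_trans.
Qed.

#[local] Instance path_concat_proper (R : realType) (T : topologicalType)
    (x y z : T) :
  Morphisms.Proper (Morphisms.respectful (@path_homotopic R T x y)
    (Morphisms.respectful (@path_homotopic R T y z) (@path_homotopic R T x z)))
  (@path_concat R T x y z).
Proof. by move=> f f' ff' g g' gg'; exact: path_homotopic_concat. Qed.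

#[local] Instance path_rev_proper (R : realType) (T : topologicalType) (x y : T) :
  Morphisms.Proper (Morphisms.respectful (@path_homotopic R T x y)
    (@path_homotopic R T y x)) (@path_rev R T x y).
Proof. by move=> f f' ff'; exact: path_homotopic_rev. Qed.

Section restriction.
Variables (R : realType) (T : topologicalType) (f : unit_itv R -> T).
Hypothesis cf : continuous f.
Local Notation I := (unit_itv R).

Definition restr_fun (s t : R) (u : I) : T :=
  f (itv_clamp (itv_coord u * (t - s) + s)).

Lemma restr_continuous s t : continuous (restr_fun s t).
Proof.
apply: comp_clamp_continuous => //; apply: addc_continuous.
exact: (@mulc_continuous _ _ _ _ (@itv_coord_continuous R)).
Qed.

Lemma restr_zero s t : restr_fun s t zero = f (itv_clamp s).
Proof. by rewrite /restr_fun coord_zero mul0r add0r. Qed.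

Lemma restr_one s t : restr_fun s t one = f (itv_clamp t).
Proof. by rewrite /restr_fun coord_one mul1r subrK. Qed.

Definition restr s t : {path I from f (itv_clamp s) to f (itv_clamp t)} :=
  mk_path (@restr_continuous s t) (restr_zero s t) (restr_one s t).

(** Both sides are reparametrizations of [f] by maps to the real line with the same
ends, and such maps are homotopic by convexity. *)
Lemma restr_concat s t r :
  path_homotopic (path_concat (restr s t) (restr t r)) (restr s r).
Proof.
have cI := @itv_coord_continuous R.
apply: (@path_homotopic_reparam _ _ _ _ _ _ f
  (fun u => Num.min 1 (2 * itv_coord u) * (t - s) + s +
            Num.max 0 (2 * itv_coord u - 1) * (r - t))
  (fun u => itv_coord u * (r - s) + s)) => //.
- have c1 : continuous (fun u : I => Num.min 1 (2 * itv_coord u) * (t - s) + s).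
    apply/addc_continuous/mulc_continuous/min_phi_continuous.
      exact: cst_phi_continuous.
    exact: double_continuous.
  have c2 : continuous (fun u : I => Num.max 0 (2 * itv_coord u - 1) * (r - t)).
    apply/mulc_continuous/max_phi_continuous; first exact: cst_phi_continuous.
    exact: double1_continuous.
  by move=> u; exact: (cvgD (c1 u) (c2 u)).
- by apply: addc_continuous; exact: mulc_continuous.
- by rewrite coord_zero min_r ?max_l; lra.
- by rewrite coord_one min_l ?max_r; lra.
- move=> u; rewrite /= /mk_path /path_concat_fun /= /mk_path /restr_fun.
  have u0 := itv_coord_ge0 u; have u1 := itv_coord_le1 u.
  case: leP => u2; rewrite itv_clampK; try (by apply/andP; split; lra).
    by congr (f (itv_clamp _)); rewrite min_r ?max_l; lra.
  by congr (f (itv_clamp _)); rewrite min_l ?max_r; lra.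
Qed.
End restriction.

Section tether.
Variables (R : realType) (T : topologicalType) (x0 : T).
Local Notation I := (unit_itv R).
Variable tau : forall x, {path I from x0 to x}.

(** Tethering both endpoints to [x0] makes the class of a path an element of one
group, whatever its endpoints; products of classes then make sense without
transport along equalities of points. *)
Definition tclass x y (f : {path I from x to y}) : pi1 R x0 :=
  pi1_class (path_concat (path_concat (tau x) f) (path_rev (tau y))).

Lemma tclass_homotopic x y (f g : {path I from x to y}) :
  path_homotopic f g -> tclass f = tclass g.
Proof. move=> fg; apply/pi1_classP; rewrite fg; reflexivity. Qed.

Lemma tclass_concat x y z (f : {path I from x to y}) (g : {path I from y to z}) :
  tclass (path_concat f g) = (tclass f * tclass g)%g.
Proof.
rewrite /tclass [RHS]pi1_mul_class; apply/pi1_classP.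
rewrite !path_concatA.
rewrite -(path_concatA (path_concat (tau x) f) (path_rev (tau y)) (tau y)).
rewrite path_concat_rev_l path_concat_cst_r; reflexivity.
Qed.

Lemma tclass_cst x : tclass (path_cst R x) = 1%g.
Proof.
apply: (@mulgI (pi1 R x0) (tclass (path_cst R x))).
rewrite mulg1 -tclass_concat; apply: tclass_homotopic.
exact: path_concat_cst_l.
Qed.

Lemma tclass_rev x y (f : {path I from x to y}) :
  tclass (path_rev f) = (tclass f)^-1%g.
Proof.
apply: (@mulgI (pi1 R x0) (tclass f)); rewrite mulgV -tclass_concat.
by rewrite (tclass_homotopic (path_concat_rev_r f)) tclass_cst.
Qed.

Lemma tclass_loop (f : {path I from x0 to x0}) :
  nulhomotopic (tau x0) -> tclass f = pi1_class f.
Proof.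
move=> t0; have {}t0 : path_homotopic (tau x0) (path_cst R x0) := t0.
apply/pi1_classP; rewrite t0 path_concat_cst_l.
have -> : path_rev (path_cst R x0) = path_cst R x0 by apply/path_eqP.
exact: path_concat_cst_r.
Qed.

(** A restriction of [f] to all of the unit interval has endpoints that are only
provably those of [f]; hence the two pairs of endpoints. *)
Lemma tclass_ext x y x' y' (f : {path I from x to y}) (g : {path I from x' to y'}) :
  f =1 g :> (I -> T) -> tclass f = tclass g.
Proof.
move=> fg.
have xx : x = x' by rewrite -(@path_zero _ _ _ _ f) fg path_zero.
have yy : y = y' by rewrite -(@path_one _ _ _ _ f) fg path_one.
by subst x' y'; congr tclass; apply/path_eqP.
Qed.

Lemma tclass_restr01 x y (f : {path I from x to y}) (cf : continuous f) :
  tclass (restr cf 0 1) = tclass f.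
Proof.
apply: tclass_ext => u.
by rewrite /= /mk_path /restr_fun subr0 mulr1 addr0 itv_coordK.
Qed.

Lemma tclass_grid x y (f : {path I from x to y}) (cf : continuous f)
    n (w : nat -> pi1 R x0) :
  (0 < n)%N ->
  (forall i, (i < n)%N ->
    tclass (restr cf (i%:R / n%:R) (i.+1%:R / n%:R)) = w i) ->
  tclass f = (\prod_(i < n) w i)%g.
Proof.
move=> n0 h; pose u (i : nat) : R := i%:R / n%:R.
have restrM s t r : (tclass (restr cf s t) * tclass (restr cf t r) =
    tclass (restr cf s r))%g.
  by rewrite -tclass_concat; apply: tclass_homotopic; exact: restr_concat.
have := @prod_telescope (pi1 R x0) w
  (fun i => tclass (restr cf (u i) 1)) n.
rewrite /u divff ?pnatr_eq0 -?lt0n // mul0r.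
(* The class of the empty restriction is idempotent. *)
rewrite tclass_restr01 (_ : tclass (restr cf 1 1) = 1%g) ?mulg1; last first.
  by apply: (@mulgI (pi1 R x0) (tclass (restr cf 1 1))); rewrite restrM mulg1.
by move=> <- // i ni; rewrite -h // restrM.
Qed.
End tether.

(** * Small triangles in length spaces *)

Section short_paths.
Variables (R : realType) (X : metricType R).
Local Notation I := (unit_itv R).

(** A consequence of having length less than [L], read off from subdivisions into
three pieces; it is all that bounding the diameters of triangles takes. *)
Definition shorter (x y : X) (f : {path I from x to y}) (L : R) : Prop :=
  forall s t : I, itv_coord s <= itv_coord t ->
    mdist x (f s) + mdist (f s) (f t) + mdist (f t) y < L.

Lemma length_space_shorter (x y : X) (e : R) : length_space X -> 0 < e ->
  exists f : {path I from x to y}, shorter f (mdist x y + e).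
Proof.
move=> /(_ x y) hX e0.
have : ((mdist x y)%:E < (mdist x y + e)%:E)%E by rewrite lte_fin ltrDl.
rewrite [X in (X < _)%E -> _]hX => /ereal_inf_lt[_ [f _ <-] fl].
exists f => s t st; rewrite -lte_fin; apply: le_lt_trans fl.
apply: ereal_sup_ubound; exists 3%N, (fun i => nth one [:: zero; s; t] i).
split => //; last first.
  by rewrite !big_ord_recr big_ord0 /= add0r path_zero path_one.
move=> [|[|[|i]]] [|[|[|j]]] //= _; rewrite ?nth_nil ?coord_zero ?coord_one
  ?itv_coord_ge0 ?itv_coord_le1 //.
Qed.

Lemma shorter_mdist (x y : X) (f : {path I from x to y}) L s t :
  shorter f L -> mdist (f s) (f t) < L.
Proof.
move=> fL; wlog st : s t / itv_coord s <= itv_coord t.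
  by move=> h; case: (leP (itv_coord s) (itv_coord t)) => [/h //|/ltW /h];
     rewrite metric_sym.
have := fL s t st; have := mdist_ge0 x (f s); have := mdist_ge0 (f t) y; lra.
Qed.

Lemma shorter_via (x y : X) (f : {path I from x to y}) L t :
  shorter f L -> mdist x (f t) + mdist (f t) y < L.
Proof. by move=> /(_ t t (lexx _)); rewrite mdistxx addr0. Qed.

(** The two arcs from [p] to [q] on the triangle together have length at most its
perimeter; here [p] and [q] lie on two sides that meet at [y]. *)
Lemma triangle_cross (x y z : X) a b c (p q : X) :
  mdist x p + mdist p y < a -> mdist y q + mdist q z < b -> mdist x z < c ->
  2 * mdist p q < a + b + c.
Proof.
move=> hp hq hc.
have := metric_triangle p y q; have := metric_triangle p x q.
have := metric_triangle x z q; rewrite (metric_sym p x) (metric_sym z q); lra.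
Qed.

(** The same bound for two points of one side. *)
Lemma triangle_side (x y z : X) (f : {path I from x to y}) a b c s t :
  shorter f a -> mdist y z < b -> mdist x z < c ->
  2 * mdist (f s) (f t) < a + b + c.
Proof.
move=> fa hb hc; wlog st : s t / itv_coord s <= itv_coord t.
  by move=> h; case: (leP (itv_coord s) (itv_coord t)) => [/h //|/ltW /h];
     rewrite metric_sym.
have := fa s t st; set p := f s; set q := f t => h.
have := metric_triangle p x q; have := metric_triangle x z q.
have := metric_triangle z y q.
by rewrite (metric_sym p x) (metric_sym z y) (metric_sym y q); lra.
Qed.

Lemma path_concat_sub (x y z : X) (A : set X) (f : {path I from x to y})
    (g : {path I from y to z}) :
  (forall t, A (f t)) -> (forall t, A (g t)) -> forall t, A (path_concat f g t).
Proof.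
by move=> fA gA t; rewrite /= /mk_path /path_concat_fun; case: ifP.
Qed.

Definition small_loops_nulhomotopic (D : R) : Prop :=
  forall (x : X) (gamma : {path I from x to x}),
    (diameter (range gamma) < (4 * D)%:E)%E -> nulhomotopic gamma.

Variables (x0 : X) (D k : R).
Hypothesis loops : small_loops_nulhomotopic D.

Lemma loop_nulhomotopic (A : set X) (c : R) (x : X) (f : {path I from x to x}) :
  (forall t, A (f t)) -> (forall p q, A p -> A q -> mdist p q <= c) ->
  c < 4 * D -> nulhomotopic f.
Proof.
move=> fA Ac cD; apply: loops.
apply: (@le_lt_trans _ _ c%:E); last by rewrite lte_fin.
apply: ge_ereal_sup => _ [[_ _] [[s _ <-] [t _ <-]] <-] /=.
by rewrite lee_fin; exact: Ac.
Qed.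

Variable e : forall x y : X, {path I from x to y}.
Hypothesis e_shorter : forall x y, shorter (e x y) (mdist x y + k).
Hypotheses (k0 : 0 < k) (kD : k <= D).

Notation tcl := (tclass (e x0)).

Definition edge_class (x y : X) : pi1 R x0 := tcl (e x y).

Lemma tether_nulhomotopic : nulhomotopic (e x0 x0).
Proof.
apply: (@loop_nulhomotopic (range (e x0 x0)) k) => //; last by move: k0 kD; lra.
move=> _ _ [s _ <-] [t _ <-]; apply/ltW.
by have := shorter_mdist s t (e_shorter x0 x0); rewrite mdistxx add0r.
Qed.

Lemma tclass_bigon (A : set X) (c : R) (x y : X) (f g : {path I from x to y}) :
  (forall t, A (f t)) -> (forall t, A (g t)) ->
  (forall p q, A p -> A q -> mdist p q <= c) -> c < 4 * D -> tcl f = tcl g.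
Proof.
move=> fA gA Ac cD; apply/eqP; rewrite -divg_eq1; apply/eqP.
rewrite -tclass_rev -tclass_concat -(tclass_cst (e x0) x).
apply: tclass_homotopic; apply: (loop_nulhomotopic _ Ac cD).
by apply: path_concat_sub => // t; exact: gA.
Qed.

(** The triangle of three almost shortest paths has diameter at most half of its
perimeter, which exceeds the sum of the three distances by at most 3k. *)
Lemma edge_class_triangle (x y z : X) :
  mdist x y + mdist y z + mdist x z + 3 * k < 8 * D ->
  (edge_class x y * edge_class y z = edge_class x z)%g.
Proof.
move=> small; rewrite /edge_class -tclass_concat.
pose A := range (e x y) `|` range (e y z) `|` range (e x z).
pose c := (mdist x y + mdist y z + mdist x z + 3 * k) / 2.
have xy : mdist x y < mdist x y + k by rewrite ltrDl.
have yz : mdist y z < mdist y z + k by rewrite ltrDl.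
have xz : mdist x z < mdist x z + k by rewrite ltrDl.
have sym := @metric_sym _ X.
have fg s t : mdist (e x y s) (e y z t) <= c.
  have := triangle_cross (shorter_via s (e_shorter x y))
    (shorter_via t (e_shorter y z)) xz; rewrite /c; lra.
have gh s t : mdist (e y z s) (e x z t) <= c.
  have := @triangle_cross y z x _ _ _ _ (e x z t) (shorter_via s (e_shorter y z)).
  move=> /(_ (mdist x z + k) (mdist x y + k)).
  rewrite (sym z) (sym _ x) addrC (shorter_via t (e_shorter x z)) (sym y) xy.
  by move=> /(_ isT isT); rewrite /c; lra.
have hf s t : mdist (e x z s) (e x y t) <= c.
  have := @triangle_cross z x y _ _ _ (e x z s) (e x y t).
  move=> /(_ (mdist x z + k) (mdist x y + k) (mdist y z + k)).
  rewrite (sym z) (sym _ x) addrC (shorter_via s (e_shorter x z)).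
  rewrite (shorter_via t (e_shorter x y)) (sym z) yz.
  by move=> /(_ isT isT isT); rewrite /c; lra.
have ff s t : mdist (e x y s) (e x y t) <= c.
  by have := triangle_side s t (e_shorter x y) yz xz; rewrite /c; lra.
have gg s t : mdist (e y z s) (e y z t) <= c.
  have := @triangle_side y z x _ _ (mdist x z + k) (mdist x y + k) s t
    (e_shorter y z).
  by rewrite (sym z) (sym y x) => /(_ xz xy); rewrite /c; lra.
have hh s t : mdist (e x z s) (e x z t) <= c.
  have := @triangle_side x z y _ _ (mdist y z + k) (mdist x y + k) s t
    (e_shorter x z).
  by rewrite (sym z) => /(_ yz xy); rewrite /c; lra.
apply: (@tclass_bigon A c).
- by apply: path_concat_sub => t; [left; left|left; right]; exists t.
- by move=> t; right; exists t.
- by move=> _ _ [[]|] [s _ <-] [[]|] [t _ <-] //; rewrite sym.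
- by rewrite /c; move: small; lra.
Qed.

(** Each short piece of [f] forms with the almost shortest path between its ends a
loop of diameter at most 3k, hence has the same class. *)
Lemma tclass_edges (x y : X) (f : {path I from x to y}) :
  exists N, forall n, (N <= n)%N ->
    tcl f = chain_prod edge_class (f \o @grid R n) n.
Proof.
have cf : continuous f := @cts_fun _ _ f.
have [N [N0 hN]] := path_unif_continuous cf k0.
exists N => n Nn; have n0 : (0 < n)%N by apply: leq_trans Nn.
apply: (@tclass_grid _ _ _ _ _ _ f cf n
  (fun i => edge_class (f (grid R n i)) (f (grid R n i.+1)))) => // i ni.
set s := i%:R / n%:R; set t := i.+1%:R / n%:R.
have st : t - s = n%:R^-1 by rewrite /s /t -mulrBl -natr1 addrAC subrr add0r mul1r.
have inv0 : (0 : R) < n%:R^-1 by rewrite invr_gt0 ltr0n.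
have pieces u u' : mdist (restr cf s t u) (restr cf s t u') < k.
  apply: (hN n) => //; rewrite st.
  have -> : itv_coord u * n%:R^-1 + s - (itv_coord u' * n%:R^-1 + s) =
    (itv_coord u - itv_coord u') * n%:R^-1 by ring.
  rewrite normrM [X in _ * X]gtr0_norm // ler_piMl ?(ltW inv0) // ler_norml.
  have := itv_coord_ge0 u; have := itv_coord_ge0 u'.
  have := itv_coord_le1 u; have := itv_coord_le1 u'.
  by move=> *; apply/andP; split; lra.
set x1 := f (itv_clamp s); set y1 := f (itv_clamp t).
have x1y1 : mdist x1 y1 < k.
  by have := pieces zero one; rewrite path_zero path_one.
have edge p : mdist x1 (e x1 y1 p) < 2 * k.
  have := shorter_mdist zero p (e_shorter x1 y1); rewrite path_zero; lra.
have sym := @metric_sym _ X.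
have cross u p : mdist (restr cf s t u) (e x1 y1 p) <= 3 * k.
  have := metric_triangle (restr cf s t u) x1 (e x1 y1 p).
  by have := pieces u zero; rewrite path_zero; have := edge p; lra.
apply: (@tclass_bigon (range (restr cf s t) `|` range (e x1 y1)) (3 * k)).
- by move=> u; left; exists u.
- by move=> u; right; exists u.
- move=> _ _ [[u _ <-]|[p _ <-]] [[u' _ <-]|[p' _ <-]] //.
  + by have := pieces u u'; move: k0; lra.
  + by rewrite sym.
  + by have := shorter_mdist p p' (e_shorter x1 y1); move: k0; lra.
- by move: k0 kD; lra.
Qed.
End short_paths.

(** * Homomorphisms induced by local cocycles *)

Section transfer.
Variables (R : realType) (Z : metricType R) (z0 : Z) (G : groupType).
Variables (v : Z -> Z -> G) (eta : R).
Hypothesis eta0 : 0 < eta.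
Hypothesis v_local : local_cocycle v eta.

Definition transfer (a : pi1 R z0) : G := holonomy v (repr a).

Lemma transfer_class f : transfer (pi1_class f) = holonomy v f.
Proof.
apply: (holonomy_homotopic eta0 v_local).
by apply/pi1_classP; rewrite pi1_class_repr.
Qed.

Lemma transferM : {morph transfer : a b / (a * b)%g}.
Proof.
move=> a b; rewrite -(pi1_class_repr a) -(pi1_class_repr b).
rewrite [(_ * _)%g]pi1_mul_class !transfer_class.
exact: (holonomy_concat eta0 v_local).
Qed.

Lemma transfer1 : transfer 1%g = 1%g.
Proof. by apply: (@mulgI G (transfer 1%g)); rewrite -transferM !mulg1. Qed.

Lemma transfer_tclass (tau : forall z, {path (unit_itv R) from z0 to z}) x y
    (f : {path (unit_itv R) from x to y}) :
  transfer (tclass tau f) =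
    (holonomy v (tau x) * holonomy v f * (holonomy v (tau y))^-1)%g.
Proof.
by rewrite /tclass transfer_class !(holonomy_concat eta0 v_local)
  (holonomy_rev eta0 v_local).
Qed.
End transfer.

(** The images of a triangle of size [k] have sides less than 2r + k, so perimeter
less than 6r + 3k, which leaves room for the 3k lost by almost shortest paths. *)
Lemma edge_class_pullback (R : realType) (X Y : metricType R) (y0 : Y)
    (D k r : R) (eY : forall y y' : Y, {path (unit_itv R) from y to y'})
    (psi : X -> Y) :
  small_loops_nulhomotopic Y D -> 0 < k -> 0 <= r -> r + k <= D ->
  (forall y y', shorter (eY y y') (mdist y y' + k)) ->
  (forall x x', mdist (psi x) (psi x') < mdist x x' + 2 * r) ->
  local_cocycle (fun x x' => edge_class y0 eY (psi x) (psi x')) k.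
Proof.
move=> loopsY k0 r0 rkD eY_shorter hpsi a b c ab bc ac.
apply: (edge_class_triangle y0 loopsY eY_shorter k0).
have := hpsi a b; have := hpsi b c; have := hpsi a c; lra.
Qed.

(** * Going to the other space and back *)

Section round_trip.
Variables (R : realType) (X Y : metricType R) (x0 : X) (y0 : Y) (D k r : R).
Local Notation I := (unit_itv R).
Hypothesis loopsX : small_loops_nulhomotopic X D.
Hypothesis loopsY : small_loops_nulhomotopic Y D.
Hypotheses (k0 : 0 < k) (r0 : 0 <= r) (rkD : r + k <= D).
Variable eX : forall x x' : X, {path I from x to x'}.
Hypothesis eX_shorter : forall x x', shorter (eX x x') (mdist x x' + k).
Variable eY : forall y y' : Y, {path I from y to y'}.
Hypothesis eY_shorter : forall y y', shorter (eY y y') (mdist y y' + k).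

Variables (psi : X -> Y) (chi : Y -> X).
Hypothesis hpsi : forall x x', mdist (psi x) (psi x') < mdist x x' + 2 * r.
Hypothesis hchi : forall y y', mdist (chi y) (chi y') < mdist y y' + 2 * r.
Hypothesis hcor : forall x y, mdist x (chi y) < mdist (psi x) y + 2 * r.

(* The holonomies of [v] and [v'] are the homomorphisms from X to Y and back. *)
Let wX := edge_class x0 eX.
Let wY := edge_class y0 eY.
Let v x x' := wY (psi x) (psi x').
Let v' y y' := wX (chi y) (chi y').
Let v_local : local_cocycle v k.
Proof.
exact: (edge_class_pullback y0 loopsY k0 r0 rkD eY_shorter hpsi).
Qed.

Let v'_local : local_cocycle v' k.
Proof.
exact: (edge_class_pullback x0 loopsX k0 r0 rkD eX_shorter hchi).
Qed.

Lemma wX_triangle x y z :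
  mdist x y + mdist y z + mdist x z + 3 * k < 8 * (r + k) ->
  (wX x y * wX y z = wX x z)%g.
Proof.
move=> h; apply: (edge_class_triangle x0 loopsX eX_shorter k0).
by move: h rkD; lra.
Qed.

(** The cone argument: all images [chi z] of points [z] of the path from [psi x] to
[psi x'] are coned off from [x], and the resulting triangles
have perimeter below 8r + 4k, leaving the 3k lost by almost shortest paths. *)
Lemma holonomy_edge x x' : mdist x x' < k ->
  holonomy v' (eY (psi x) (psi x')) =
    ((wX x (chi (psi x)))^-1 * wX x x' * wX x' (chi (psi x')))%g.
Proof.
move=> xx'; set f := eY _ _.
have cf : continuous f := @cts_fun _ _ f.
have [N1 hN1] := holonomyP k0 v'_local cf.
have [N2 [N20 hN2]] := path_unif_continuous cf k0.
have [n [nN1 nN2 n0]] : exists n, [/\ (N1 <= n)%N, (N2 <= n)%N & (0 < n)%N].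
  by exists (maxn N1 N2); rewrite !leq_max !leqnn orbT N20 orbT.
pose z i := f (grid R n i).
have z0 : z 0%N = psi x by rewrite /z grid_start path_zero.
have zn : z n = psi x' by rewrite /z grid_end ?n0 ?leqnn // path_one.
have zz i : mdist (z i) (z i.+1) < k.
  by apply: (hN2 n) => //; apply: grid_step; rewrite leqnSn leqnn.
(* [z i] is reached from either end of the path; the two estimates through [x]
  and through [x'] add up to at most its length, below 2r + 2k, plus 4r + k. *)
have xz i : 2 * mdist x (chi (z i)) < 6 * r + 3 * k.
  have := shorter_via (grid R n i) (eY_shorter (psi x) (psi x')).
  rewrite -/(z i); have := hpsi x x'.
  have := hcor x (z i); have := hcor x' (z i).
  have := metric_triangle x x' (chi (z i)).
  by rewrite (metric_sym (z i)); move: xx'; lra.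
have := @prod_telescope (pi1 R x0) (fun i => v' (z i) (z i.+1))
  (fun i => (wX x (chi (z i)))^-1%g) n.
rewrite z0 zn => telescope.
rewrite -(hN1 n) //.
have -> : chain_prod v' (f \o grid R n) n =
    ((wX x (chi (psi x)))^-1 * wX x (chi (psi x')))%g.
  apply: (@mulIg _ (wX x (chi (psi x')))^-1%g); rewrite mulgK.
  apply: telescope => i _.
  apply: (@mulgI _ (wX x (chi (z i)))); rewrite mulgV mulgA.
  rewrite wX_triangle ?mulgV //.
  have := xz i; have := xz i.+1; have := zz i; have := hchi (z i) (z i.+1).
  by move: k0 r0; lra.
rewrite -mulgA wX_triangle //.
have := hcor x' (psi x'); have := hcor x (psi x').
have := hpsi x x'; rewrite mdistxx; move: k0 r0 xx'; lra.
Qed.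

Lemma transfer_round_trip : exists g : pi1 R x0, forall a : pi1 R x0,
  (transfer v' (transfer v a : pi1 R y0) = g * a * g^-1)%g.
Proof.
pose h y := holonomy v' (eY y0 y).
(* The correction at a sample [x]: the tether of [psi x] brought back to [X],
  then the edge from [chi (psi x)] back to [x]. *)
pose g x := (h (psi x) * (wX x (chi (psi x)))^-1)%g.
exists (g x0) => a; pose f := repr a.
have kD : k <= D by move: r0 rkD; lra.
have cf : continuous f := @cts_fun _ _ f.
have [N1 hN1] := tclass_edges x0 loopsX eX_shorter k0 kD f.
have [N2 hN2] := holonomyP k0 v_local cf.
have [N3 [N30 hN3]] := path_unif_continuous cf k0.
have [n [nN1 nN2 nN3 n0]] :
    exists n, [/\ (N1 <= n)%N, (N2 <= n)%N, (N3 <= n)%N & (0 < n)%N].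
  by exists (maxn N1 (maxn N2 N3)); rewrite !leq_max !leqnn !orbT N30 !orbT.
pose c i := f (grid R n i).
have c0 : c 0%N = x0 by rewrite /c grid_start path_zero.
have cn : c n = x0 by rewrite /c grid_end ?n0 ?leqnn // path_one.
have cc i : mdist (c i) (c i.+1) < k.
  by apply: (hN3 n) => //; apply: grid_step; rewrite leqnSn leqnn.
have aE : a = chain_prod wX c n.
  rewrite -[LHS]pi1_class_repr -(@tclass_loop _ _ _ (eX x0)); first exact: hN1.
  exact: (tether_nulhomotopic x0 loopsX eX_shorter k0 kD).
have -> : transfer v a = chain_prod v c n by rewrite /transfer -(hN2 n).
rewrite /chain_prod.
rewrite (big_morph _ (transferM k0 v'_local) (transfer1 _ k0 v'_local)).
apply: (@mulIg _ (g x0)); rewrite mulgVK [in RHS]aE.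
suff : (\prod_(i < n) transfer v' (v (c i) (c i.+1)) * g (c n) =
    g (c 0%N) * chain_prod wX c n)%g by rewrite c0 cn.
apply: (@prod_ladder _ (fun i => transfer v' (v (c i) (c i.+1)))
  (fun i => wX (c i) (c i.+1)) (fun i => g (c i))) => i _.
rewrite /v /wY /edge_class (transfer_tclass k0 v'_local) (holonomy_edge (cc i)).
by rewrite /g !mulgA mulgVK mulgK.
Qed.
End round_trip.

(** * Maps between spaces at small Gromov-Hausdorff distance *)

(** In the common ambient space [psi] and [chi] move every point by less than [r],
which gives all four estimates by the triangle inequality; the last two compare
[psi] with [chi] without asking that they be inverse to each other. *)
Lemma gromov_hausdorff_maps (R : realType) (X Y : metricType R) (x0 : X) (D : R) :
  (gromov_hausdorff_dist X Y < D%:E)%E ->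
  exists (r : R) (psi : X -> Y) (chi : Y -> X), [/\ 0 <= r < D,
    forall x x', mdist (psi x) (psi x') < mdist x x' + 2 * r,
    forall y y', mdist (chi y) (chi y') < mdist y y' + 2 * r,
    forall x y, mdist x (chi y) < mdist (psi x) y + 2 * r &
    forall y x, mdist y (psi x) < mdist (chi y) x + 2 * r].
Proof.
move=> /ereal_inf_lt[_ [Z [X' [Y' [[i [iX _ iS] im] [j [jY _ jS] jm] ->]]]]] hD.
have [r mr rD] : exists2 r : R, (hausdorff_dist X' Y' < r%:E)%E & r < D.
  move: hD; case: (hausdorff_dist X' Y') => [a| |] //=.
    by rewrite lte_fin => aD; exists ((a + D) / 2); rewrite ?lte_fin; lra.
  by move=> _; exists (D - 1); rewrite ?ltNyr //; lra.
have exY x : exists y, mdist (i x) (j y) < r.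
  have : (dist_to_set (i x) Y' < r%:E)%E.
    apply: le_lt_trans mr; rewrite /hausdorff_dist le_max; apply/orP; left.
    by apply: ereal_sup_ubound; exists (i x) => //; exact: iX.
  move=> /ereal_inf_lt[_ [z Yz <-]]; rewrite lte_fin => zr.
  by have [y _ yz] := jS z Yz; exists y; rewrite yz.
have exX y : exists x, mdist (j y) (i x) < r.
  have : (dist_to_set (j y) X' < r%:E)%E.
    apply: le_lt_trans mr; rewrite /hausdorff_dist le_max; apply/orP; right.
    by apply: ereal_sup_ubound; exists (j y) => //; exact: jY.
  move=> /ereal_inf_lt[_ [z Xz <-]]; rewrite lte_fin => zr.
  by have [x _ xz] := iS z Xz; exists x; rewrite xz.
have [psi hpsi] := choice exY; have [chi hchi] := choice exX.
have r0 : 0 <= r by apply: le_trans (ltW (hpsi x0)); exact: mdist_ge0.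
have sym := @metric_sym _ Z; have tri := @metric_triangle _ Z.
exists r, psi, chi; rewrite r0 rD; split => // [x x'|y y'|x y|y x].
- rewrite -im -jm; have := hpsi x; have := hpsi x'; rewrite (sym (i x)).
  have := tri (j (psi x)) (i x) (j (psi x')).
  by have := tri (i x) (i x') (j (psi x')); lra.
- rewrite -im -jm; have := hchi y; have := hchi y'; rewrite (sym (j y)).
  have := tri (i (chi y)) (j y) (i (chi y')).
  by have := tri (j y) (j y') (i (chi y')); lra.
- rewrite -im -jm; have := hpsi x; have := hchi y.
  have := tri (i x) (j (psi x)) (i (chi y)).
  by have := tri (j (psi x)) (j y) (i (chi y)); lra.
- rewrite -im -jm; have := hpsi x; have := hchi y.
  have := tri (j y) (i (chi y)) (j (psi x)).
  by have := tri (i (chi y)) (i x) (j (psi x)); lra.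
Qed.

Lemma isomorphic_groups_bij (G H : groupType) (f : G -> H) :
  {morph f : a b / (a * b)%g} -> bijective f -> isomorphic_groups G H.
Proof.
move=> fM bf; pose mf := isMultiplicative.Build G H f fM.
by pose F : {multiplicative G -> H} := HB.pack f mf; exists F.
Qed.

(** * The isomorphism *)

Theorem theorem1p3 (R : realType) (X Y : metricType R) (x0 : X) (y0 : Y)
    (hX : length_space X) (hY : length_space Y) (D : R) (hD : 0 < D)
    (hGH : (gromov_hausdorff_dist X Y < D%:E)%E)
    (loopsX : forall (x : X) (gamma : {path (unit_itv R) from x to x}),
      (diameter (range gamma) < (4 * D)%:E)%E -> nulhomotopic gamma)
    (loopsY : forall (y : Y) (gamma : {path (unit_itv R) from y to y}),
      (diameter (range gamma) < (4 * D)%:E)%E -> nulhomotopic gamma) :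
  isomorphic_groups (pi1 R x0) (pi1 R y0).
Proof.
have [r [psi [chi [/andP[r0 rD] hpsi hchi hcor hcor']]]] :=
  gromov_hausdorff_maps x0 hGH.
(* All the small margins can be taken equal to the gap between [r] and [D]. *)
pose k := D - r.
have k0 : 0 < k by rewrite subr_gt0.
have rkD : r + k <= D by rewrite addrC subrK.
pose eX x x' := projT1 (cid (length_space_shorter x x' hX k0)).
pose eY y y' := projT1 (cid (length_space_shorter y y' hY k0)).
have eX_shorter x x' : shorter (eX x x') (mdist x x' + k).
  exact: projT2 (cid (length_space_shorter x x' hX k0)).
have eY_shorter y y' : shorter (eY y y') (mdist y y' + k).
  exact: projT2 (cid (length_space_shorter y y' hY k0)).
have v_local := edge_class_pullback y0 loopsY k0 r0 rkD eY_shorter hpsi.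
have [g hg] := transfer_round_trip x0 y0 loopsX loopsY k0 r0 rkD
  eX_shorter eY_shorter hpsi hchi hcor.
have [h hh] := transfer_round_trip y0 x0 loopsY loopsX k0 r0 rkD
  eY_shorter eX_shorter hchi hpsi hcor'.
apply: (@isomorphic_groups_bij _ _ _ (transferM k0 v_local)).
move: hg hh; set phi' := transfer _; set phi := transfer _ => hg hh.
have phiK : cancel phi (fun b => g^-1 * phi' b * g)%g.
  by move=> a; rewrite hg !mulgA mulVg mul1g mulgVK.
exists (fun b => g^-1 * phi' b * g)%g => // b.
have -> : b = phi (phi' (h^-1 * b * h)%g).
  by rewrite hh !mulgA mulgV mul1g mulgK.
by rewrite phiK.
Qed.
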